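(* Let $U:[a,b]\to\mathbb F$ be left-continuous and of bounded variation, and let $DU$ be its canonical derivative measure on $[a,b)$. Then $$U\in AC_g([a,b])\quad\Longleftrightarrow\quad DU\ll\mu_g .$$ In this case, $D_gU=\dfrac{dDU}{d\mu_g}$ $\mu_g$-almost everywhere.
   Context: Let $\mathbb F$ be $\mathbb R$ or $\mathbb C$, let $a<b$ be real, and let $g:[a,b]\to\mathbb R$ be nondecreasing and left-continuous. $\mu_g$ is the finite Lebesgue--Stieltjes measure on $[a,b)$ with $\mu_g([s,t))=g(t)-g(s)$ for $a\le s\le t\le b$. Standing assumption: $M_g:=\mu_g([a,b))=g(b)-g(a)>0$. $L_g^1([a,b))$ is the $L^1$ space of $\mathbb F$-valued functions for the completion of $\mu_g$. $AC_g([a,b])$ is the set of $u:[a,b]\to\mathbb F$ such that for every $\varepsilon>0$ there is $\delta>0$ such that, for every finite family of pairwise disjoint intervals $[a_j,b_j)\subset[a,b)$, $\sum_j(g(b_j)-g(a_j))<\delta$ implies $\sum_j|u(b_j)-u(a_j)|<\varepsilon$. It is known that $u\in AC_g([a,b])$ if and only if there is $v\in L_g^1([a,b))$ with $u(t)=u(a)+\int_{[a,t)}v\,d\mu_g$ for all $t\in[a,b]$; $v$ is unique $\mu_g$-a.e. and the Stieltjes derivative is $D_gu:=v$. For a left-continuous $U:[a,b]\to\mathbb F$ of bounded variation, $DU$ denotes the canonical finite signed or complex Borel measure on $[a,b)$ characterized by $DU([s,t))=U(t)-U(s)$ for $a\le s\le t\le b$ (so a mass $U(a^+)-U(a)$ at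 $a$ is included). *)

(* Defs.v *)
From HB Require Import structures.
From mathcomp Require Import all_boot all_order all_algebra.
From mathcomp Require Import all_classical all_reals all_analysis.
From mathcomp Require Import complex.

Set Implicit Arguments.
Unset Strict Implicit.
Unset Printing Implicit Defensive.

Import Order.TTheory GRing.Theory Num.Theory.
Import numFieldNormedType.Exports.

Local Open Scope classical_set_scope.
Local Open Scope ring_scope.

Variant scalar_kind := Reals | Complexes.

Definition scalarType (R : realType) (k : scalar_kind) : numFieldType :=
  match k with Reals => R | Complexes => R[i] end.

(* A function on [a, b] is represented by a total function on R of which only
   the values on [a, b] are ever used; hence no condition at t = a here. *)
Definition left_continuous_on (R : realType) (V : topologicalType)
    (a b : R) (f : R -> V) : Prop :=
  forall t, a < t -> t <= b -> f x @[x --> t^'-] --> f t.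

(* [numfun.bounded_variation] only covers real-valued functions. The norm of
   [scalarType R k] takes its values in [scalarType R k] itself; a bound of a sum of
   norms, like a positive eps below, is automatically real. *)
Definition bounded_variation_on (R : realType) (k : scalar_kind)
    (a b : R) (u : R -> scalarType R k) : Prop :=
  exists M : scalarType R k, forall s : seq R, itv_partition a b s ->
    \sum_(x <- zip s (a :: s)) `|u x.1 - u x.2| <= M.

Definition AC_wrt (R : realType) (k : scalar_kind) (a b : R) (g : R -> R)
    (u : R -> scalarType R k) : Prop :=
  forall eps : scalarType R k, 0 < eps ->
  exists2 delta : R, 0 < delta &
    forall (n : nat) (l r : 'I_n -> R),
      (forall j, [/\ a <= l j, l j < r j & r j <= b]) ->
      trivIset [set: 'I_n] (fun j => `[l j, r j[%classic) ->
      \sum_j (g (r j) - g (l j)) < delta ->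
      \sum_j `|u (r j) - u (l j)| < eps.

(* Measures on [a, b) are Borel measures on R vanishing outside [a, b). *)
Definition is_stieltjes_measure (R : realType) (a b : R) (g : R -> R)
    (mu : set R -> \bar R) : Prop :=
  (forall s t, a <= s -> s <= t -> t <= b -> mu `[s, t[%classic = (g t - g s)%:E) /\
  mu (~` `[a, b[%classic) = 0%E.

(* Charges are finite, so that a complex measure is a pair of charges. *)
Definition scalar_charge (R : realType) (k : scalar_kind) : Type :=
  match k with
  | Reals => {charge set R -> \bar R}
  | Complexes => ({charge set R -> \bar R} * {charge set R -> \bar R})%type
  end.

Definition charge_val (R : realType) (k : scalar_kind) :
    scalar_charge R k -> set R -> scalarType R k :=
  match k with
  | Reals => fun nu A => fine (nu A)
  | Complexes => fun nu A => Complex (fine (nu.1 A)) (fine (nu.2 A))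
  end.

Definition is_derivative_measure (R : realType) (k : scalar_kind) (a b : R)
    (U : R -> scalarType R k) (nu : scalar_charge R k) : Prop :=
  (forall s t, a <= s -> s <= t -> t <= b ->
    charge_val nu `[s, t[%classic = U t - U s) /\
  (forall A : set R, measurable A -> A `<=` ~` `[a, b[%classic -> charge_val nu A = 0).

Definition scalar_dominates (R : realType) (k : scalar_kind)
    (nu : scalar_charge R k) (mu : set R -> \bar R) : Prop :=
  forall A : set R, measurable A -> mu A = 0%E -> charge_val nu A = 0.

Definition scalar_Radon_Nikodym (R : realType) (k : scalar_kind) :
    scalar_charge R k -> {finite_measure set R -> \bar R} -> R -> scalarType R k :=
  match k with
  | Reals => fun nu mu x => fine (Radon_Nikodym nu mu x)
  | Complexes => fun nu mu x =>
      Complex (fine (Radon_Nikodym nu.1 mu x))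
              (fine (Radon_Nikodym nu.2 mu x))
  end.

(* The completion lives on the Caratheodory sigma-algebra of the outer measure
   induced by mu, which for a finite Borel measure mu is the completion of the
   Borel sigma-algebra with respect to mu. *)
Notation completion mu := (@completed_measure_extension _ _ _ mu).

Definition scalar_integrable (R : realType) (k : scalar_kind)
    (mu : {finite_measure set R -> \bar R}) (D : set R) :
    (R -> scalarType R k) -> Prop :=
  match k with
  | Reals => fun v =>
      (completion mu).-integrable D (EFin \o v)
  | Complexes => fun v =>
      (completion mu).-integrable D
        (fun x => (complex.Re (v x))%:E) /\
      (completion mu).-integrable D
        (fun x => (complex.Im (v x))%:E)
  end.

Definition scalar_integral (R : realType) (k : scalar_kind)
    (mu : {finite_measure set R -> \bar R}) (D : set R) :
    (R -> scalarType R k) -> scalarType R k :=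
  match k with
  | Reals => fun v => Rintegral (completion mu) D v
  | Complexes => fun v =>
      Complex
        (Rintegral (completion mu) D (fun x => complex.Re (v x)))
        (Rintegral (completion mu) D (fun x => complex.Im (v x)))
  end.

Definition is_stieltjes_derivative (R : realType) (k : scalar_kind) (a b : R)
    (mu : {finite_measure set R -> \bar R}) (u v : R -> scalarType R k) : Prop :=
  scalar_integrable mu `[a, b[%classic v /\
  forall t, a <= t -> t <= b -> u t = u a + scalar_integral mu `[a, t[%classic v.

(* A representative of D_g u, which is unique up to mu-a.e. equality; the
   default value 0 is only taken when u has no Stieltjes derivative. *)
Definition stieltjes_derivative (R : realType) (k : scalar_kind) (a b : R)
    (mu : {finite_measure set R -> \bar R}) (u : R -> scalarType R k) :
    R -> scalarType R k :=
  xget (fun=> 0) [set v | is_stieltjes_derivative a b mu u v].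

(* Main.v *)
From HB Require Import structures.
Require Import Defs.
From mathcomp Require Import all_boot all_order all_algebra.
From mathcomp Require Import all_classical all_reals all_analysis.
From mathcomp Require Import complex measurable_realfun ring.
Import Order.TTheory GRing.Theory Num.Theory.
Import numFieldNormedType.Exports.
Local Open Scope classical_set_scope.
Local Open Scope ring_scope.

(* If mu A = 0, approximate A by a finite union E of half-open intervals, up to
   a set that is small for mu + |DU| at once: mu E is then small, absolute
   continuity makes the increments of U over E, hence DU E, small, and DU A is
   close to DU E. The converse is the epsilon-delta form of |DU| << mu. A
   Radon-Nikodym density is a Stieltjes derivative, so the last claim reduces to
   uniqueness: an integrable h with zero integral over every [a, t) induces a
   charge that vanishes on intervals, and the first step, applied with the zero
   measure as mu, shows that this charge is zero; it determines the integrals of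
   h over all measurable sets of the completion because each of these has a
   Borel hull. A complex U is treated through its real and imaginary parts. *)

(** * Finite unions of half-open intervals *)

(* E is a union of cells of the partition of D cut out by the points of s; in
   this form stability under Boolean operations is immediate. *)
Definition step_on {R : realType} (D : set R) (s : seq R) (E : set R) : Prop :=
  forall x y, D x -> D y -> {in s, forall p, (p <= x) = (p <= y)} -> E x -> E y.

(** Induction on the cut points: a point [p] inside the interval splits it into [[a, p[] and [[p,
    b[], and within each half [p] no longer separates any two points. An arbitrary finite index type
    lets the two families be glued by a sum type. *)
Lemma step_on_partition {R : realType} (s : seq R) (E : set R) (a b : R) :
  a < b -> step_on `[a, b[ s E ->
  exists (I : finType) (l r : I -> R),
    [/\ forall j, [/\ a <= l j, l j < r j & r j <= b],
        trivIset [set: I] (fun j => `[l j, r j[%classic) &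
        E `&` `[a, b[ = \bigcup_j `[l j, r j[%classic].
Proof.
elim: s a b => [|p s ih] a b ab Es.
  (* Without cut points, [E] contains all of [[a, b[] or none of it, and membership of [a] decides
     which. *)
  have [Ea|nEa] := pselect (E a).
    exists unit, (fun=> a), (fun=> b); split => //.
      by move=> [] [].
    apply/seteqP; split => [x [_ abx]|x [[] _ abx]]; first by exists tt.
    split => //; apply: (Es a) => //; rewrite /= in_itv /= lexx; exact: ab.
  exists void, (fun=> a), (fun=> b); split => //.
  apply/seteqP; split => [x [Ex abx]|x [[]//]].
  by exfalso; apply: nEa; apply: (Es x) => //; rewrite /= in_itv /= lexx ab.
have [/andP[ap pb]|npab] := boolP (a < p < b); last first.
  apply: ih => // x y xab yab xy; apply: Es => // q; rewrite inE => /orP[/eqP->|/xy//].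
  move: npab xab yab; rewrite /= !in_itv/= negb_and -!leNgt.
  move=> /orP[pa|bp] /andP[ax xb] /andP[ay yb].
    by rewrite (le_trans pa ax) (le_trans pa ay).
  by rewrite !leNgt (lt_le_trans xb bp) (lt_le_trans yb bp).
have [|I1 [l1 [r1 [h1 t1 e1]]]] := ih a p ap.
  move=> x y; rewrite /= !in_itv/= => /andP[ax xp] /andP[ay yp] xy.
  apply: Es; rewrite /= ?in_itv/= ?ax ?ay/= ?(lt_trans xp)// ?(lt_trans yp)//.
  by move=> q; rewrite inE => /orP[/eqP->|/xy//]; rewrite !leNgt xp yp.
have [|I2 [l2 [r2 [h2 t2 e2]]]] := ih p b pb.
  move=> x y; rewrite /= !in_itv/= => /andP[px xb] /andP[py yb] xy.
  apply: Es; rewrite /= ?in_itv/= ?xb ?yb ?andbT ?(le_trans (ltW ap))//.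
  by move=> q; rewrite inE => /orP[/eqP->|/xy//]; rewrite px py.
exists (I1 + I2)%type.
exists (fun i => match i with inl j => l1 j | inr j => l2 j end).
exists (fun i => match i with inl j => r1 j | inr j => r2 j end); split.
- move=> [j|j]; [have [? ? ?] := h1 j|have [? ? ?] := h2 j]; split => //.
    by apply: le_trans (ltW pb).
  by apply: le_trans (ltW ap) _.
- have disj i j x : `[l1 i, r1 i[%classic x -> `[l2 j, r2 j[%classic x -> False.
    have [_ _ rp] := h1 i; have [pl _ _] := h2 j.
    rewrite /= !in_itv/= => /andP[_ xr] /andP[lx _].
    by have := lt_le_trans (le_lt_trans (le_trans pl lx) xr) rp; rewrite ltxx.
  move=> [i|i] [j|j] _ _ [x []].
  + by move=> *; congr inl; apply: t1 => //; exists x.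
  + by move=> /disj /[apply].
  + by move=> /[swap] /disj /[apply].
  + by move=> *; congr inr; apply: t2 => //; exists x.
- have -> : `[a, b[%classic = `[a, p[%classic `|` `[p, b[%classic.
    by rewrite -itv_bndbnd_setU // bnd_simp ltW.
  rewrite setIUr e1 e2; apply/seteqP; split => x.
    by move=> [[j _ jx]|[j _ jx]]; [exists (inl j)|exists (inr j)].
  by move=> [[j|j] _ jx]; [left; exists j|right; exists j].
Qed.

(** Reindexing by ordinals, the form in which [AC_wrt] takes its families. *)
Lemma step_on_itv_partition {R : realType} (s : seq R) (E : set R) (a b : R) :
  a < b -> step_on `[a, b[ s E ->
  exists n (l r : 'I_n -> R),
    [/\ forall j, [/\ a <= l j, l j < r j & r j <= b],
        trivIset [set: 'I_n] (fun j => `[l j, r j[%classic) &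
        E `&` `[a, b[ = \bigcup_j `[l j, r j[%classic].
Proof.
move=> ab /(step_on_partition _ _ _ _ ab)[J [l [r [lr tlr ->]]]].
exists #|J|, (l \o enum_val), (r \o enum_val); split => //.
    by move=> j; exact: lr.
  by move=> i j _ _ /= /(tlr _ _ I I)/enum_val_inj.
apply/seteqP; split => [x [j _ jx]|x [j _ jx]]; last by exists (enum_val j).
by exists (enum_rank j) => //=; rewrite enum_rankK.
Qed.

Lemma step_onC {R : realType} (D : set R) (s : seq R) (E : set R) :
  step_on D s E -> step_on D s (~` E).
Proof.
move=> Es x y Dx Dy xy nEx Ey; apply: nEx; apply: Es Ey => // p ps.
by rewrite xy.
Qed.

Lemma step_onU {R : realType} (D : set R) (s t : seq R) (E F : set R) :
  step_on D s E -> step_on D t F -> step_on D (s ++ t) (E `|` F).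
Proof.
move=> Es Ft x y Dx Dy xy [Ex|Fx]; [left; apply: Es Ex|right; apply: Ft Fx] => //.
  by move=> p ps; rewrite xy// mem_cat ps.
by move=> p pt; rewrite xy// mem_cat pt orbT.
Qed.

(** * Approximation of Borel sets in measure *)

Lemma measurableY d (T : ringOfSetsType d) (A B : set T) :
  measurable A -> measurable B -> measurable (A `+` B).
Proof. by move=> mA mB; apply: measurableU; apply: measurableD. Qed.

Lemma le_measureU {d} {T : ringOfSetsType d} {R : realType}
    (m : {measure set T -> \bar R}) (A B C : set T) :
  measurable A -> measurable B -> measurable C -> A `<=` B `|` C ->
  (m A <= m B + m C)%E.
Proof.
move=> mA mB mC ABC; apply: le_trans (measureU2 _ _ _) => //.
by apply: le_measure; rewrite ?inE//; apply: measurableU.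
Qed.

Section step_approximation.
Context {R : realType} (m : {measure set R -> \bar R}).
Hypothesis mfin : (m setT < +oo)%E.

Definition step_approximable (A : set R) : Prop :=
  measurable A /\ forall eps : R, 0 < eps ->
  exists s E, [/\ step_on setT s E, measurable E & (m (A `+` E) < eps%:E)%E].

Lemma step_approximable0 : step_approximable set0.
Proof.
split=> // eps eps0; exists [::], set0; split => //.
by rewrite setYK measure0 lte_fin.
Qed.

Lemma step_approximableC A : step_approximable A -> step_approximable (~` A).
Proof.
move=> [mA apA]; split; first exact: measurableC.
move=> eps /apA[s [E [Es mE AE]]]; exists s, (~` E); split.
- exact: step_onC.
- exact: measurableC.
- suff -> : ~` A `+` ~` E = A `+` E by [].
  by rewrite /setY !setDE !setCK setUC [X in X `|` _]setIC [X in _ `|` X]setIC.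
Qed.

Lemma step_approximableU A B :
  step_approximable A -> step_approximable B -> step_approximable (A `|` B).
Proof.
move=> [mA apA] [mB apB]; split; first exact: measurableU.
move=> eps eps0; have e2 : 0 < eps / 2 by rewrite divr_gt0.
have [s [E [Es mE AE]]] := apA _ e2; have [t [F [Ft mF BF]]] := apB _ e2.
exists (s ++ t), (E `|` F); split.
- exact: step_onU.
- exact: measurableU.
- rewrite (splitr eps) EFinD; apply: le_lt_trans (lteD AE BF).
  apply: le_measureU; try apply: measurableY => //; try exact: measurableU.
  move=> x [[[Ax|Bx] /not_orP[nE nF]]|[[Ex|Fx] /not_orP[nA nB]]].
  + by left; left.
  + by right; left.
  + by left; right.
  + by right; right.
Qed.

(** The finite unions [B n] increase to the whole union. Since [m] is finite, continuity from above
    makes the remainder [C n] small for large [n]; half of [eps] pays for the remainder and half for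
    approximating one [B N]. *)
Lemma step_approximable_bigcup (A : (set R)^nat) :
  (forall n, step_approximable (A n)) -> step_approximable (\bigcup_n A n).
Proof.
move=> apA.
have mA : measurable (\bigcup_n A n) by apply: bigcupT_measurable => n; case: (apA n).
pose B n := \big[setU/set0]_(i < n) A i.
have apB n : step_approximable (B n).
  elim: n => [|n ih]; rewrite /B; first by rewrite big_ord0; exact: step_approximable0.
  by rewrite big_ord_recr/=; exact: step_approximableU.
have mB n : measurable (B n) by case: (apB n).
have BA n : B n `<=` \bigcup_n A n.
  by rewrite /B -bigcup_mkord => x [k _ Akx]; exists k.
pose C n := \bigcup_n A n `\` B n.
have mC n : measurable (C n) by exact: measurableD.
have C0 : m (C n) @[n --> \oo] --> 0%E.
  rewrite -(measure0 m); have <- : \bigcap_n C n = set0.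
    apply/seteqP; split => // x /= Cx; have [[k _ Akx] _] := Cx 0%N I.
    (* [B n] only collects the indices below [n], so a point of [A k] first has to appear in
       [B k.+1]. *)
    have [_] := Cx k.+1 I; apply; rewrite /B -bigcup_mkord; exists k => //=.
  apply: nonincreasing_cvg_mu => //.
  - by apply: le_lt_trans mfin; apply: le_measure; rewrite ?inE.
  - by apply: bigcapT_measurable.
  - move=> p q pq; apply/subsetPset => x [Ax nB]; split => //.
    by apply: contra_not nB; exact: subset_bigsetU.
split=> // eps eps0; have e2 : 0 < eps / 2 by rewrite divr_gt0.
have [N _ /(_ N (leqnn N))/= CN] : \forall n \near \oo, (m (C n) < (eps / 2)%:E)%E.
  have /fine_cvgP[Cfin /cvgr_lt Clt] := C0.
  near=> n; rewrite -(@fineK _ (m (C n))); last by near: n.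
  by rewrite lte_fin; near: n; exact: Clt.
have [s [E [Es mE BE]]] := (apB N).2 _ e2.
exists s, E; split => //; rewrite (splitr eps) EFinD.
apply: le_lt_trans (lteD CN BE); apply: le_measureU => //; try exact: measurableY.
move=> x [[Ax nE]|[Ex nA]].
  by have [Bx|nB] := pselect (B N x); [right; left|left].
by right; right; split => // /BA.
Unshelve. all: by end_near. Qed.

(** The approximable sets form a sigma-algebra, and they include the closed rays [[p, +oo[], which
    generate the Borel sets: such a ray is itself a step set with the single cut point [p]. *)
Lemma measurable_step_approximable A : measurable A -> step_approximable A.
Proof.
move=> mA.
have : (@RGenCInfty.G R).-sigma.-measurable A by rewrite -RGenCInfty.measurableE.
apply: smallest_sub.
  split; first exact: step_approximable0.
    by move=> B; rewrite setTD; exact: step_approximableC.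
  exact: step_approximable_bigcup.
move=> _ [p ->]; split => // eps eps0; exists [:: p], `[p, +oo[%classic; split => //.
  move=> x y _ _ /(_ p); rewrite inE eqxx => /(_ isT) xy.
  by rewrite /= !in_itv/= !andbT xy.
by rewrite setYK measure0 lte_fin.
Qed.

End step_approximation.

(** * Absolute continuity against domination, real case *)

(** Only additivity on two disjoint sets is assumed, so that measures and charges are covered at
    once. *)
Lemma additive2_bigcup_ord {d} {T : ringOfSetsType d} {R : numFieldType}
    {f : set T -> \bar R} : f set0 = 0%E -> additive2 f ->
  forall n (F : 'I_n -> set T), (forall i, measurable (F i)) ->
  trivIset setT F -> f (\bigcup_i F i) = (\sum_(i < n) f (F i))%E.
Proof.
move=> f0 fD; elim => [|n ih] F mF tF.
  rewrite big_ord0 -[RHS]f0; congr f; apply/seteqP; split => // x [[]//].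
pose G (i : 'I_n) := F (widen_ord (leqnSn n) i).
have -> : \bigcup_i F i = \bigcup_i G i `|` F ord_max.
  apply/seteqP; split => [x [i _ Fix]|x [[i _ Gix]|Fx]].
  - case: (unliftP ord_max i) => [j|] ij; last by right; rewrite -ij.
    by left; exists j => //; rewrite /G; rewrite ij in Fix;
      congr (F _ x) : Fix; apply: val_inj; rewrite /= /bump leqNgt ltn_ord.
  - by exists (widen_ord (leqnSn n) i).
  - by exists ord_max.
rewrite fD//; last 2 first.
- by apply: fin_bigcup_measurable => // i _; exact: mF.
- apply/seteqP; split => // x [[i _ Gix] Fx].
  have /(congr1 val)/= := tF (widen_ord (leqnSn n) i) ord_max I I (ex_intro _ x (conj Gix Fx)).
  by move=> ein; have := ltn_ord i; rewrite ein ltnn.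
rewrite ih ?big_ord_recr//.
  by move=> i; exact: mF.
by move=> i j _ _ /tF -/(_ I I) /(congr1 val)/= /val_inj.
Qed.

(** Stated for any finite measure with the prescribed values on intervals, so that it also applies
    to the zero measure with a constant [g]. *)
Lemma AC_scalar_dominates {R : realType} (a b : R) (g U : R -> R)
    (mu : {measure set R -> \bar R}) (nu : {charge set R -> \bar R}) :
  a < b -> (mu setT < +oo)%E -> is_stieltjes_measure a b g mu ->
  @is_derivative_measure R Reals a b U nu ->
  @AC_wrt R Reals a b g U -> @scalar_dominates R Reals nu mu.
Proof.
move=> ab mufin [mug mu0] [nuU nu0] ac.
have nufin A : measurable A -> nu A \is a fin_num by exact: fin_num_measure.
(* The part of a null set outside [[a, b[] has no [nu]-mass, so only subsets of [[a, b[] matter. *)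
suff H A : measurable A -> A `<=` `[a, b[ -> mu A = 0%E -> fine (nu A) = 0.
  move=> A mA muA /=.
  have mI : measurable (A `&` `[a, b[) by exact: measurableI.
  rewrite (chargeDI nu mA (measurable_itv `[a, b[)) fineD ?nufin//; last exact: measurableD.
  rewrite [X in X + _](nu0 _ _ _) ?add0r; [|exact: measurableD|by move=> x []].
  by apply: H => //; exact: subset_measure0 muA.
move=> mA Aab muA.
have [P [N nuPN]] := Hahn_decomposition nu.
pose var : {measure set R -> \bar R} := charge_variation nuPN.
have varfin : (var setT < +oo)%E by rewrite -ge0_fin_numE//; exact: fin_num_measure.
pose m : {measure set R -> \bar R} := measure_add mu var.
have mE B : m B = (mu B + var B)%E by exact: measure_addE.
have mfin : (m setT < +oo)%E by rewrite mE lte_add_pinfty.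
apply/eqP; rewrite -normr_le0; apply/ler_addgt0Pr => eps eps0; rewrite add0r.
have e2 : 0 < eps / 2 by rewrite divr_gt0.
have [del del0 acd] := ac _ e2.
(* The bound [del] will control the [mu]-mass of the step set, and [eps / 2] the variation of [nu]
   on the symmetric difference. *)
have [|s [E [Es mEE AE]]] := (measurable_step_approximable m mfin A mA).2 (Num.min (eps / 2) del).
  by rewrite lt_min e2.
have [|n [l [r [lr tlr Elr]]]] := step_on_itv_partition s E a b ab.
  by move=> x y _ _; exact: Es.
(* As [A] lies in [[a, b[], cutting [E] down to it can only shrink the symmetric difference. *)
pose E' := E `&` `[a, b[.
have mE' : measurable E' by exact: measurableI.
have sub : A `+` E' `<=` A `+` E.
  move=> x [[Ax nE]|[[Ex _] nA]]; last by right.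
  by left; split => // Ex; apply: nE; split => //; exact: Aab.
have mAE' : (m (A `+` E') < (Num.min (eps / 2) del)%:E)%E.
  by apply: le_lt_trans AE; apply: le_measure; rewrite ?inE//; exact: measurableY.
(* Up to the [mu]-null set [A], the set [E'] is contained in the symmetric difference. *)
have muE' : (mu E' < del%:E)%E.
  apply: (@le_lt_trans _ _ (m (A `+` E'))); last first.
    by apply: lt_le_trans mAE' _; rewrite lee_fin ge_min lexx orbT.
  rewrite mE -[leLHS]adde0; apply: leeD => //.
  rewrite -[leRHS]adde0 -muA; apply: le_measureU => //; first exact: measurableY.
  by move=> x Ex; have [|nA] := pselect (A x); [right|left; right].
have varAE' : (var (A `+` E') < (eps / 2)%:E)%E.
  apply: (@le_lt_trans _ _ (m (A `+` E'))).
    by rewrite mE leeDr.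
  by apply: lt_le_trans mAE' _; rewrite lee_fin ge_min lexx.
have nuE' : `|fine (nu E')| < eps / 2.
  rewrite /E' Elr (additive2_bigcup_ord (charge0 nu) (@chargeU _ _ _ nu))//.
  rewrite -sum_fine; last by move=> j _; rewrite nufin.
  apply: (le_lt_trans (ler_norm_sum _ _ _)).
  rewrite (eq_bigr (fun j => `|U (r j) - U (l j)|)); last first.
    move=> j _; congr (`|_|); have [alj lrj rb] := lr j.
    by have := nuU (l j) (r j) alj (ltW lrj) rb.
  apply: acd => //.
  rewrite -lte_fin; apply: le_lt_trans muE'.
  rewrite /E' Elr (additive2_bigcup_ord (measure0 mu))//; last by move=> B C mB mC BC; exact: measureU.
  rewrite -sumEFin; apply: lee_sum => j _.
  by have [alj lrj rb] := lr j; rewrite /= mug// ltW.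
(* Both [A] and [E'] are split along their intersection, whose mass cancels; the two differences
   that remain are disjoint and together form the symmetric difference. *)
have nuDI : fine (nu A) = fine (nu (A `\` E')) - fine (nu (E' `\` A)) + fine (nu E').
  rewrite (chargeDI nu mA mE') (chargeDI nu mE' mA) setIC.
  rewrite !fineD ?nufin//; try exact: measurableD; try exact: measurableI.
  ring.
rewrite nuDI (splitr eps) (le_trans (ler_normD _ _))// lerD ?(ltW nuE')//.
rewrite (le_trans (ler_normB _ _))//.
have varF B : measurable B -> var B \is a fin_num.
  by move=> mB; rewrite ge0_fin_numE// (le_lt_trans _ varfin)// le_measure ?inE.
have bnd B : measurable B -> `|fine (nu B)| <= fine (var B).
  move=> mB; rewrite -fine_abse ?nufin// fine_le ?abse_fin_num ?nufin ?varF//.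
  exact: abse_charge_variation.
rewrite (le_trans (lerD (bnd _ _) (bnd _ _)))//; try exact: measurableD.
rewrite -fineD ?varF//; try exact: measurableD.
rewrite -measureU//; try exact: measurableD.
  by rewrite -lee_fin fineK ?ltW// varF//; exact: measurableY.
by apply/seteqP; split => // x [[Ax nE] [Ex nA]].
Qed.

Lemma scalar_dominatesRE {R : realType} (nu : {charge set R -> \bar R})
    (mu : {measure set R -> \bar R}) :
  @scalar_dominates R Reals nu mu <-> nu `<< mu.
Proof.
split=> [numu|/null_content_dominatesP numu A mA muA]; last by rewrite /= numu.
apply/null_content_dominatesP => A mA muA.
by rewrite -[nu A]fineK ?fin_num_measure//; congr EFin; exact: numu.
Qed.

(** The variation of [nu], rather than [nu], is tested on the union of the family: it is additive
    and bounds each increment in absolute value, so no cancellation between increments can hide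
    their sum. *)
Lemma scalar_dominates_AC {R : realType} (a b : R) (g U : R -> R)
    (mu : {measure set R -> \bar R}) (nu : {charge set R -> \bar R}) :
  is_stieltjes_measure a b g mu -> @is_derivative_measure R Reals a b U nu ->
  @scalar_dominates R Reals nu mu -> @AC_wrt R Reals a b g U.
Proof.
move=> [mug _] [nuU _] /scalar_dominatesRE numu eps eps0.
have [P [N nuPN]] := Hahn_decomposition nu.
have [del [del0 mudel]] := charge_variation_continuous nuPN numu eps0.
exists del => // n l r lr tlr gdel.
have mlr j : measurable `[l j, r j[%classic by exact: measurable_itv.
have mUlr : measurable (\bigcup_j `[l j, r j[%classic).
  exact: fin_bigcup_measurable.
rewrite -lte_fin; apply: le_lt_trans (mudel _ mUlr _); last first.
  rewrite (additive2_bigcup_ord (measure0 mu))//; last first.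
    by move=> B C mB mC BC; exact: measureU.
  rewrite (eq_bigr (fun j => (g (r j) - g (l j))%:E)) ?sumEFin ?lte_fin//.
  by move=> j _; have [alj lrj rb] := lr j; rewrite /= mug// ltW.
rewrite (additive2_bigcup_ord (measure0 (charge_variation nuPN)))//; last first.
  by move=> B C mB mC BC; exact: measureU.
rewrite -sumEFin; apply: lee_sum => j _; have [alj lrj rb] := lr j.
have <- : fine (nu `[l j, r j[%classic) = U (r j) - U (l j).
  by rewrite -nuU// ltW.
apply: le_trans (abse_charge_variation nuPN (mlr j)).
by rewrite -fine_abse ?fin_num_measure// fineK// abse_fin_num fin_num_measure.
Qed.

(** * Integration against the completed measure *)

Section completion.
Local Open Scope ereal_scope.
Context {d} {T : measurableType d} {R : realType}.
Variable mu : {finite_measure set T -> \bar R}.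
Local Notation cmu := (completion mu).

(** For each [n] a countable measurable cover has total mass within [1 / (n + 1)] of the outer
    measure, which is finite; the hull is the intersection over [n] of the unions of these
    covers. *)
Lemma mu_ext_hull (X : set T) :
  exists B, [/\ measurable B, X `<=` B & mu B = mu_ext mu X].
Proof.
have Xfin : mu_ext mu X \is a fin_num.
  rewrite ge0_fin_numE ?mu_ext_ge0//.
  apply: (@le_lt_trans _ _ (mu_ext mu setT)); first exact: le_mu_ext.
  by rewrite measurable_mu_extE// -ge0_fin_numE// fin_num_measure.
have cover n : exists F : (set T)^nat, measurable_cover X F /\
    \sum_(k <oo) mu (F k) < mu_ext mu X + (n.+1%:R^-1)%:E.
  have n0 : (0 < n.+1%:R^-1 :> R)%R by rewrite invr_gt0.
  by have [_ [F XF <-] Fn] := lb_ereal_inf_adherent n0 Xfin; exists F.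
have [F /all_and2[XF Fn]] := choice cover.
have mF n : measurable (\bigcup_k F n k) by apply: bigcupT_measurable => k; exact: (XF n).1.
have mB : measurable (\bigcap_n \bigcup_k F n k) by exact: bigcapT_measurable.
have XB : X `<=` \bigcap_n \bigcup_k F n k by move=> x Xx n _; exact: (XF n).2.
exists (\bigcap_n \bigcup_k F n k); split => //.
apply/eqP; rewrite eq_le; apply/andP; split; last first.
  by rewrite -measurable_mu_extE//; exact: le_mu_ext.
apply/lee_addgt0Pr => e e0.
have [n ne] : exists n, (n.+1%:R^-1 < e :> R)%R.
  by exists (Num.truncn e^-1); rewrite invf_plt ?posrE// truncnS_gt.
apply: (@le_trans _ _ (mu (\bigcup_k F n k))).
  apply: le_measure; rewrite ?inE//; exact: bigcap_inf.
apply: (@le_trans _ _ (\sum_(k <oo) mu (F n k))).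
  apply: measure_sigma_subadditive => //; exact: (XF n).1.
by apply: (le_trans (ltW (Fn n))); rewrite leeD2l// lee_fin ltW.
Qed.

(** The hull of a null set of the completion is a measurable [mu]-null set. *)
Lemma ae_completion (P : T -> Prop) :
  {ae cmu, forall x, P x} -> {ae mu, forall x, P x}.
Proof.
move=> [A [mA A0 PA]]; have [B [mB AB Bmu]] := mu_ext_hull A.
by exists B; split => //; [rewrite Bmu|exact: subset_trans AB].
Qed.

(** The identity, seen as a map from the Caratheodory sigma-algebra to the original one, is
    measurable and pushes the completion forward to [mu]; integrals are then transferred by change
    of variables. *)
Let idT : caratheodory_type (mu_ext mu) -> T := id.

Let measurable_idT : measurable_fun setT idT.
Proof. by move=> _ A mA; rewrite setTI; exact: caratheodory_measurable_mu_ext. Qed.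

Let pushforward_idT A : measurable A -> pushforward cmu idT A = mu A.
Proof. by move=> mA; rewrite /pushforward /= /completed_measure_extension measurable_mu_extE. Qed.

Lemma integrable_completion (f : T -> \bar R) :
  mu.-integrable setT f -> cmu.-integrable setT f.
Proof.
move=> /integrableP[mf foo]; apply/integrableP; split.
  move=> _ B mB; rewrite setTI; apply: caratheodory_measurable_mu_ext.
  by rewrite -[X in measurable X]setTI; exact: mf.
have <- : \int[pushforward cmu idT]_x `|f x| = \int[cmu]_x `|f x|.
  by rewrite ge0_integral_pushforward//; exact: measurableT_comp.
rewrite (eq_measure_integral mu)//= => A mA _; exact: pushforward_idT.
Qed.

Lemma integral_completion (f : T -> \bar R) (A : set T) :
  mu.-integrable setT f -> measurable A ->
  \int[cmu]_(x in A) f x = \int[mu]_(x in A) f x.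
Proof.
move=> fi mA; have mcA : measurable (A : set (caratheodory_type (mu_ext mu))).
  exact: caratheodory_measurable_mu_ext.
have <- : \int[pushforward cmu idT]_(x in A) f x = \int[cmu]_(x in A) f x.
  rewrite integral_pushforward//; first exact: measurable_int fi.
  exact: (integrableS measurableT mcA (@subsetT _ _) (integrable_completion _ fi)).
by apply: eq_measure_integral => B mB _; exact: pushforward_idT.
Qed.

(** The indefinite integral over the completion, meant for sets of the original sigma-algebra. The
    integrability proof is an argument because the charge structure declared below depends on it. *)
Definition completion_charge (f : T -> \bar R) (_ : cmu.-integrable setT f)
  (A : set T) := \int[cmu]_(x in A) f x.

Variable f : T -> \bar R.
Hypothesis fi : cmu.-integrable setT f.
Local Notation nu := (completion_charge f fi).

Let completion_charge0 : nu set0 = 0.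
Proof. exact: integral_set0. Qed.

Let completion_charge_fin A : measurable A -> nu A \is a fin_num.
Proof.
move=> mA; have mcA := caratheodory_measurable_mu_ext mu mA.
by apply: integrable_fin_num => //; exact: (integrableS measurableT mcA (@subsetT _ _) fi).
Qed.

Let completion_charge_sigma_additive : semi_sigma_additive nu.
Proof.
move=> F mF tF mUF; apply: (charge_semi_sigma_additive (s := induced_charge fi)) => //.
  by move=> i; exact: caratheodory_measurable_mu_ext.
exact: caratheodory_measurable_mu_ext.
Qed.

HB.instance Definition _ := isCharge.Build _ _ _ nu
  completion_charge0 completion_charge_fin completion_charge_sigma_additive.

End completion.

(** * Uniqueness and existence of the Stieltjes derivative, real case *)

(** A constant function is absolutely continuous with respect to a constant [g], whose Stieltjes
    measure is zero; domination by a measure for which every set is null leaves no mass. *)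
Lemma derivative_charge_eq0 {R : realType} (a b : R) (nu : {charge set R -> \bar R}) :
  a < b -> @is_derivative_measure R Reals a b (cst 0) nu ->
  forall A, measurable A -> nu A = 0%E.
Proof.
move=> ab nu0 A mA.
have mzero0 : is_stieltjes_measure a b (cst 0) (@mzero _ R R).
  by split => // s t _ _ _; rewrite subrr.
have ac : @AC_wrt R Reals a b (cst 0) (cst 0).
  move=> eps eps0; exists 1 => // n l r _ _ _.
  by under eq_bigr do rewrite subrr normr0; rewrite big1.
have mfin : (@mzero _ R R setT < +oo)%E by exact: ltry.
by have /scalar_dominatesRE/null_content_dominatesP/(_ A mA erefl) :=
  AC_scalar_dominates a b _ _ mzero nu ab mfin mzero0 nu0 ac.
Qed.

Section stieltjes_uniqueness.
Context {R : realType} (mu : {finite_measure set R -> \bar R}).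
Local Notation cmu := (completion mu).
Let C : measurableType _ := caratheodory_type (mu_ext mu).

Let measurable_cara (A : set R) : measurable A -> measurable (A : set C).
Proof. exact: caratheodory_measurable_mu_ext. Qed.

Lemma completion_integral_eq0 (a b : R) (h : R -> R) : a < b ->
  cmu.-integrable `[a, b[%classic (EFin \o h) ->
  (forall t, a <= t -> t <= b -> Rintegral cmu `[a, t[%classic h = 0) ->
  {ae mu, forall x, x \in `[a, b[ -> h x = 0}.
Proof.
move=> ab hi h0.
have mab : measurable (`[a, b[%classic : set C) by exact: measurable_cara.
(* Extension by zero outside [[a, b[] turns the integral of [h] into a charge on the whole line. *)
have hDi : cmu.-integrable setT ((EFin \o h) \_ `[a, b[%classic).
  by rewrite -integrable_mkcond.
have intE A : A `<=` `[a, b[%classic ->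
    (\int[cmu]_(x in A) (h x)%:E = \int[cmu]_(x in A) ((EFin \o h) \_ `[a, b[) x)%E.
  by move=> Aab; apply: eq_integral => x /set_mem /Aab xab; rewrite patchE mem_set.
pose nu : {charge set R -> \bar R} := completion_charge _ _ hDi.
have nuat t : a <= t -> t <= b -> nu `[a, t[%classic = 0%E.
  move=> at_ tb; have sub : `[a, t[%classic `<=` `[a, b[%classic.
    by apply: subset_itvl; rewrite bnd_simp.
  (* [Rintegral] also vanishes when the integral is infinite, as [fine] sends infinities to 0;
     integrability rules this out. *)
  rewrite /nu /= /completion_charge -intE// -[LHS]fineK.
    by congr EFin; exact: h0.
  apply: integrable_fin_num; first exact: measurable_cara.
  by apply: integrableS hi => //; exact: measurable_cara.
have nu0 : @is_derivative_measure R Reals a b (cst 0) nu.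
  split=> [s t as_ st tb|A mA Aab]; last first.
    rewrite /= /completion_charge (eq_integral (cst 0%E)) ?integral0// => x xA.
    by rewrite patchE memNset//; apply: Aab; exact: set_mem.
  rewrite subrr /=; suff -> : nu `[s, t[%classic = 0%E by [].
  have := nuat t (le_trans as_ st) tb.
  rewrite (@itv_bndbnd_setU _ _ (BLeft a) (BLeft s) (BLeft t)) ?bnd_simp//.
  rewrite chargeU// ?nuat ?add0e// ?(le_trans st)//.
  apply/seteqP; split => // x []; rewrite /= !in_itv/= => /andP[_ xs] /andP[sx _].
  by have := lt_le_trans xs sx; rewrite ltxx.
have {}nu0 := derivative_charge_eq0 a b nu ab nu0.
have : {ae cmu, forall x, `[a, b[%classic x -> (h x)%:E = 0%E}.
  apply: (@integral_ae_eq _ C R cmu _ mab (cst 0%E) (EFin \o h)) => //.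
  move=> E Eab mE; rewrite integral0.
  (* [E] is only Caratheodory measurable while [nu] is known to vanish on Borel sets. The hull, cut
     down to [[a, b[], is a Borel set differing from [E] by a null set, so both carry the same
     integral of [h]. *)
  have [B [mB EB muB]] := mu_ext_hull mu E.
  pose B' := B `&` `[a, b[%classic.
  have mB' : measurable (B' : set R) by exact: measurableI.
  have mB'C := measurable_cara _ mB'.
  have EB' : E `<=` B' by move=> x Ex; split; [exact: EB|exact: Eab].
  have mN : measurable (B' `\` E : set C) by exact: measurableD.
  have cE : cmu E = cmu B'.
    apply/eqP; rewrite eq_le; apply/andP; split; first exact: le_mu_ext.
    apply: (@le_trans _ _ (mu_ext mu B)); first by apply: le_mu_ext => x [].
    by rewrite (@measurable_mu_extE _ _ _ mu B mB); move/eqP: muB; rewrite eq_le => /andP[].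
  have Efin : (cmu E < +oo)%E.
    by rewrite /completed_measure_extension -muB -ge0_fin_numE// fin_num_measure.
  have N0 : cmu (B' `\` E) = 0%E.
    have BEE : B' `&` E = E by apply/setIidr.
    have B'fin : (cmu B' < +oo)%E by rewrite -cE.
    have := @measureD _ C R cmu B' E mB'C mE B'fin.
    rewrite BEE => ->; have BE := esym cE.
    by apply: etrans (congr1 (fun z => z - _)%E BE) _; rewrite subee// ge0_fin_numE.
  have B'i : cmu.-integrable B' (EFin \o h).
    by apply: (integrableS mab) => // x [].
  have := negligible_integral mN mB'C B'i N0.
  rewrite setDD setIidr// => <-.
  by rewrite intE; [exact: nu0 mB'|move=> x []].
move=> /ae_completion; apply: filterS => x /= xh xab.
by have [] := xh xab.
Qed.
End stieltjes_uniqueness.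

(** The density integrates over [[a, t[] to [nu] of that interval, which is [U t - U a], and its
    integrals for [mu] and for the completion agree. *)
Lemma Radon_Nikodym_is_stieltjes_derivative {R : realType} (a b : R) (U : R -> R)
    (mu : {finite_measure set R -> \bar R}) (nu : {charge set R -> \bar R}) :
  @is_derivative_measure R Reals a b U nu -> nu `<< mu ->
  @is_stieltjes_derivative R Reals a b mu U (@scalar_Radon_Nikodym R Reals nu mu).
Proof.
move=> [nuU nu0] numu.
have RNi := Radon_Nikodym_integrable numu.
(* The chosen density is finite everywhere, so [fine] does not alter it. *)
have RNE : EFin \o @scalar_Radon_Nikodym R Reals nu mu = Radon_Nikodym nu mu.
  by apply/funext => x /=; rewrite fineK// Radon_Nikodym_fin_num.
split=> [|t at_ tb].
  rewrite /scalar_integrable RNE.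
  apply: (integrableS measurableT _ (@subsetT _ _) (integrable_completion _ _ RNi)).
  exact: caratheodory_measurable_mu_ext.
rewrite /scalar_integral /Rintegral -[X in integral _ _ X]/(EFin \o _) RNE.
rewrite integral_completion//.
by rewrite -Radon_Nikodym_integral//; have /= -> := nuU a t (lexx a) at_ tb; rewrite addrC subrK.
Qed.

(** Both integrals over [[a, t[] equal [U t - U a], so the difference [v - w] integrates to zero
    there. *)
Lemma stieltjes_derivative_unique {R : realType} (a b : R) (U v w : R -> R)
    (mu : {finite_measure set R -> \bar R}) : a < b ->
  @is_stieltjes_derivative R Reals a b mu U v ->
  @is_stieltjes_derivative R Reals a b mu U w ->
  {ae mu, forall x, x \in `[a, b[ -> v x = w x}.
Proof.
move=> ab [vi Uv] [wi Uw].
have mcara (A : set R) : measurable A -> measurable (A : set (caratheodory_type (mu_ext mu))).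
  exact: caratheodory_measurable_mu_ext.
have : {ae mu, forall x, x \in `[a, b[ -> v x - w x = 0}.
  apply: (completion_integral_eq0 mu a b (fun x => v x - w x)) => // [|t at_ tb].
    by apply: (integrableB _ vi wi); exact: mcara.
  have sub : `[a, t[%classic `<=` (`[a, b[%classic : set R).
    by apply: subset_itvl; rewrite bnd_simp.
  have mat : measurable (`[a, t[%classic : set R) by exact: measurable_itv.
  have mab : measurable (`[a, b[%classic : set R) by exact: measurable_itv.
  have vit := integrableS (mcara _ mab) (mcara _ mat) sub vi.
  have wit := integrableS (mcara _ mab) (mcara _ mat) sub wi.
  rewrite RintegralB//; last exact: mcara.
  by apply/eqP; rewrite subr_eq0 -(inj_eq (addrI (U a))) -[eqbLHS]Uv// -[eqbRHS]Uw.
by apply: filterS => x /= + xab => /(_ xab)/eqP; rewrite subr_eq0 => /eqP.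
Qed.

(** * Reduction of complex scalars to real and imaginary parts *)

Section complex_components.
Context {R : realType}.
Implicit Types (a b : R) (U v : R -> R[i]).

Lemma normc_le_ReIm (z : R[i]) :
  `|z| <= (`|complex.Re z| + `|complex.Im z|)%:C%C.
Proof.
rewrite normc_def lecR -[leRHS]ger0_norm ?addr_ge0// -sqrtr_sqr ler_wsqrtr//.
rewrite sqrrD !real_normK ?num_real// addrAC lerDl.
by rewrite mulrn_wge0// mulr_ge0.
Qed.

Lemma normc_ge_Im (z : R[i]) : `|complex.Im z|%:C%C <= `|z|.
Proof. by rewrite normc_def lecR -sqrtr_sqr ler_wsqrtr// lerDr sqr_ge0. Qed.

(** Each component is bounded by the modulus, and the modulus by the sum of both components, each of
    which is allowed half of the tolerance. *)
Lemma AC_wrt_complexP a b (g : R -> R) U :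
  @AC_wrt R Complexes a b g U <->
  @AC_wrt R Reals a b g (fun x => complex.Re (U x)) /\
  @AC_wrt R Reals a b g (fun x => complex.Im (U x)).
Proof.
split=> [ac|[acR acI]].
  split=> eps eps0.
    have [|del del0 acd] := ac (eps%:C)%C; first by rewrite ltcR.
    exists del => // n l r lr tlr /(acd _ _ _ lr tlr) Ueps.
    rewrite -ltcR; apply: le_lt_trans Ueps; rewrite rmorph_sum/=.
    by apply: ler_sum => j _; rewrite -raddfB; exact: normc_ge_Re.
  have [|del del0 acd] := ac (eps%:C)%C; first by rewrite ltcR.
  exists del => // n l r lr tlr /(acd _ _ _ lr tlr) Ueps.
  rewrite -ltcR; apply: le_lt_trans Ueps; rewrite rmorph_sum/=.
  by apply: ler_sum => j _; rewrite -raddfB; exact: normc_ge_Im.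
(* In the order of [R[i]] a positive number has zero imaginary part, so its real part serves as the
   tolerance. *)
move=> eps; rewrite ltcE/= => /andP[/eqP eps_real eps0].
have e2 : 0 < complex.Re eps / 2 by rewrite divr_gt0.
have [d1 d10 ac1] := acR _ e2; have [d2 d20 ac2] := acI _ e2.
exists (Num.min d1 d2); first by rewrite lt_min d10.
move=> n l r lr tlr; rewrite lt_min => /andP[/(ac1 _ _ _ lr tlr) h1 /(ac2 _ _ _ lr tlr) h2].
have -> : eps = (complex.Re eps)%:C%C.
  by apply/eqP; rewrite eq_complex/= eqxx eps_real eqxx.
apply: (@le_lt_trans _ _ (\sum_j (`|complex.Re (U (r j)) - complex.Re (U (l j))| +
    `|complex.Im (U (r j)) - complex.Im (U (l j))|)%:C%C)).
  by apply: ler_sum => j _; rewrite -!raddfB; exact: normc_le_ReIm.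
by rewrite -rmorph_sum ltcR big_split/= [ltRHS]splitr ltrD.
Qed.

Lemma is_derivative_measure_complexP a b U
    (nu : {charge set R -> \bar R} * {charge set R -> \bar R}) :
  @is_derivative_measure R Complexes a b U nu ->
  @is_derivative_measure R Reals a b (fun x => complex.Re (U x)) nu.1 /\
  @is_derivative_measure R Reals a b (fun x => complex.Im (U x)) nu.2.
Proof.
move=> [nuU nu0]; split; split.
- by move=> s t as_ st tb; rewrite -raddfB/= -nuU.
- by move=> A mA Aab; have [] := nu0 A mA Aab.
- by move=> s t as_ st tb; rewrite -raddfB/= -nuU.
- by move=> A mA Aab; have [] := nu0 A mA Aab.
Qed.

Lemma scalar_dominates_complexP (mu : set R -> \bar R)
    (nu : {charge set R -> \bar R} * {charge set R -> \bar R}) :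
  @scalar_dominates R Complexes nu mu <->
  @scalar_dominates R Reals nu.1 mu /\ @scalar_dominates R Reals nu.2 mu.
Proof.
split=> [numu|[numu1 numu2] A mA A0].
  by split=> A mA A0; have [] := numu A mA A0.
by have /= -> := numu1 A mA A0; have /= -> := numu2 A mA A0.
Qed.

Lemma is_stieltjes_derivative_complexP a b (mu : {finite_measure set R -> \bar R}) U v :
  @is_stieltjes_derivative R Complexes a b mu U v <->
  @is_stieltjes_derivative R Reals a b mu (fun x => complex.Re (U x)) (fun x => complex.Re (v x)) /\
  @is_stieltjes_derivative R Reals a b mu (fun x => complex.Im (U x)) (fun x => complex.Im (v x)).
Proof.
split=> [[[vR vI] Uv]|[[vR UR] [vI UI]]].
  by split; split => // t at_ tb; rewrite (Uv t at_ tb) raddfD.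
split=> // t at_ tb; apply/eqP; rewrite eq_complex.
by rewrite !raddfD/= (UR t) ?(UI t)// !eqxx.
Qed.

End complex_components.

(** * Statements for both scalar fields *)

Lemma stieltjes_derivative_ae_eq {R : realType} {k : scalar_kind} (a b : R)
    (mu : {finite_measure set R -> \bar R}) (U v w : R -> scalarType R k) : a < b ->
  is_stieltjes_derivative a b mu U v -> is_stieltjes_derivative a b mu U w ->
  {ae mu, forall x, x \in `[a, b[ -> v x = w x}.
Proof.
case: k U v w => U v w ab; first exact: stieltjes_derivative_unique.
move=> /is_stieltjes_derivative_complexP[vR vI] /is_stieltjes_derivative_complexP[wR wI].
have := stieltjes_derivative_unique a b _ _ _ mu ab vR wR.
have := stieltjes_derivative_unique a b _ _ _ mu ab vI wI.
apply: filterS2 => x /= vwI vwR xab; apply/eqP.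
by rewrite eq_complex vwI// vwR// !eqxx.
Qed.

Lemma AC_wrt_dominatesP {R : realType} {k : scalar_kind} (a b : R) (g : R -> R)
    (mu : {finite_measure set R -> \bar R}) (U : R -> scalarType R k)
    (nu : scalar_charge R k) : a < b -> is_stieltjes_measure a b g mu ->
  is_derivative_measure a b U nu -> AC_wrt a b g U <-> scalar_dominates nu mu.
Proof.
move=> ab mug; have mufin : (mu setT < +oo)%E by rewrite -ge0_fin_numE// fin_num_measure.
case: k U nu => U nu nuU.
  by split; [exact: (AC_scalar_dominates a b)|exact: scalar_dominates_AC].
have [nuR nuI] := is_derivative_measure_complexP _ _ _ _ nuU.
rewrite AC_wrt_complexP; split=> [[acR acI]|].
  apply/scalar_dominates_complexP.
  split; [exact: AC_scalar_dominates mug nuR acR|exact: AC_scalar_dominates mug nuI acI].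
move=> /scalar_dominates_complexP[dR dI].
by split; [exact: scalar_dominates_AC mug nuR dR|exact: scalar_dominates_AC mug nuI dI].
Qed.

Lemma scalar_Radon_Nikodym_is_derivative {R : realType} {k : scalar_kind} (a b : R)
    (mu : {finite_measure set R -> \bar R}) (U : R -> scalarType R k)
    (nu : scalar_charge R k) : is_derivative_measure a b U nu ->
  scalar_dominates nu mu ->
  is_stieltjes_derivative a b mu U (scalar_Radon_Nikodym nu mu).
Proof.
case: k U nu => U nu nuU.
  by move=> /scalar_dominatesRE; exact: Radon_Nikodym_is_stieltjes_derivative.
have [nuR nuI] := is_derivative_measure_complexP _ _ _ _ nuU.
move=> /scalar_dominates_complexP[/scalar_dominatesRE dR /scalar_dominatesRE dI].
by apply/is_stieltjes_derivative_complexP; split; exact: Radon_Nikodym_is_stieltjes_derivative.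
Qed.

Theorem corollary9p2 (R : realType) (k : scalar_kind) (a b : R) (g : R -> R)
    (mu : {finite_measure set R -> \bar R})
    (U : R -> scalarType R k) (DU : scalar_charge R k)
    (ab : a < b)
    (g_nondecr : {in `[a, b] &, {homo g : x y / x <= y}})
    (g_left : left_continuous_on a b g)
    (mu_g : is_stieltjes_measure a b g mu)
    (M_g : g a < g b)
    (U_left : left_continuous_on a b U)
    (U_bv : bounded_variation_on a b U)
    (DU_U : is_derivative_measure a b U DU) :
  (AC_wrt a b g U <-> scalar_dominates DU mu) /\
  (AC_wrt a b g U ->
    {ae mu, forall x, x \in `[a, b[ ->
      stieltjes_derivative a b mu U x = scalar_Radon_Nikodym DU mu x}).
Proof.
have acP := AC_wrt_dominatesP a b g mu U DU ab mu_g DU_U.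
split=> // /acP DUmu.
have RN := scalar_Radon_Nikodym_is_derivative a b mu U DU DU_U DUmu.
(* The Radon-Nikodym density witnesses that a Stieltjes derivative exists, so [xget] returns a
   genuine one instead of its default, and uniqueness compares the two. *)
by apply: (stieltjes_derivative_ae_eq _ _ _ _ _ _ ab _ RN); exact: (xgetI _ RN).
Qed.
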